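(* Let $\Gamma$ be a local type environment and $\mathcal{M},\mathcal{M}'$ multiparty sessions with $\Gamma\vdash\mathcal{M}$ and $\mathcal{M}\to^*\mathcal{M}'$. If $\mathcal{M}'\Rrightarrow\big(\mathtt{p}\triangleleft\mathtt{q}!\ell_i(e).P\mid\mathtt{q}\triangleleft\sum_{j\in J}\mathtt{p}?\ell_j(x_j).Q_j\mid\mathcal{M}''\big)$ for some $P$, $e$, $Q_j$, $x_j$ and session $\mathcal{M}''$, then $i\in J$.
   Context: PROCESSES. Processes: $P ::= \mathtt{p}!\ell(e).P \mid \sum_{i\in I}\mathtt{p}?\ell_i(x_i).P_i \mid \mathtt{if}\ e\ \mathtt{then}\ P\ \mathtt{else}\ P \mid \mu X.P \mid X \mid \mathbf{0}$, with $I$ finite nonempty, recursion guarded; expressions $e$ are variables, values (booleans, integers, naturals) or built with operators such as $\mathtt{succ}$, $\mathtt{neg}$, $\neg$ and nondeterministic choice; $e\downarrow v$ is standard evaluation. Sessions: $\mathcal{M} ::= \mathtt{p}\triangleleft P \mid \mathcal{M}\mid\mathcal{M} \mid \mathcal{O}$; $\prod_{i\in I}\mathtt{p}_i\triangleleft P_i$ is parallel composition. Structural congruence $\equiv$ is the least congruence with $\mathcal{M}\mid\mathcal{N}\equiv\mathcal{N}\mid\mathcal{M}$, $(\mathcal{L}\mid\mathcal{M})\mid\mathcal{N}\equiv\mathcal{L}\mid(\mathcal{M}\mid\mathcal{N})$, $\mathcal{M}\mid\mathcal{O}\equiv\mathcal{M}$. Unfolding $\Rrightarrow$ is the least relation with: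 $\mathcal{M}\equiv\mathcal{N}\Rightarrow\mathcal{M}\Rrightarrow\mathcal{N}$; transitivity; $\mathtt{p}\triangleleft\mu X.P\mid\mathcal{N}\Rrightarrow\mathtt{p}\triangleleft P[\mu X.P/X]\mid\mathcal{N}$; $e\downarrow\mathtt{true}\Rightarrow \mathtt{p}\triangleleft\mathtt{if}\ e\ \mathtt{then}\ P\ \mathtt{else}\ Q\mid\mathcal{N}\Rrightarrow\mathtt{p}\triangleleft P\mid\mathcal{N}$; $e\downarrow\mathtt{false}\Rightarrow \mathtt{p}\triangleleft\mathtt{if}\ e\ \mathtt{then}\ P\ \mathtt{else}\ Q\mid\mathcal{N}\Rrightarrow\mathtt{p}\triangleleft Q\mid\mathcal{N}$. Labelled reduction is the least relation with: (R-comm) if $j\in I$ and $e\downarrow v$ then $\mathtt{q}\triangleleft\sum_{i\in I}\mathtt{p}?\ell_i(x_i).P_i\mid\mathtt{p}\triangleleft\mathtt{q}!\ell_j(e).Q\mid\mathcal{N}\xrightarrow{(\mathtt{p},\mathtt{q})\ell_j}\mathtt{q}\triangleleft P_j[v/x_j]\mid\mathtt{p}\triangleleft Q\mid\mathcal{N}$; (R-unfold) if $\mathcal{M}\Rrightarrow\mathcal{M}'$, $\mathcal{M}'\xrightarrow{\lambda}\mathcal{N}'$ and $\mathcal{N}'\Rrightarrow\mathcal{N}$ then $\mathcal{M}\xrightarrow{\lambda}\mathcal{N}$. $\mathcal{M}\to\mathcal{M}'$ iff $\mathcal{M}\xrightarrow{\lambda}\mathcal{M}'$ for some $\lambda$;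 $\to^*$ is the reflexive transitive closure. TYPES. Sorts $\mathtt{int},\mathtt{bool},\mathtt{nat}$, subsorting $\le$ least reflexive with $\mathtt{nat}\le\mathtt{int}$. Local types coinductively: $T ::= \mathtt{end}\mid\mathtt{p}\&\{\ell_i(S_i).T_i\}_{i\in I}\mid\mathtt{p}\oplus\{\ell_i(S_i).T_i\}_{i\in I}$. Subtyping $\le$: largest relation with $\mathtt{end}\le\mathtt{end}$; $\mathtt{p}\&\{\ell_i(S_i).T_i\}_{i\in I\cup J}\le\mathtt{p}\&\{\ell_i(S'_i).T'_i\}_{i\in I}$ if $S'_i\le S_i$, $T_i\le T'_i$ for $i\in I$; $\mathtt{p}\oplus\{\ell_i(S_i).T_i\}_{i\in I}\le\mathtt{p}\oplus\{\ell_i(S'_i).T'_i\}_{i\in I\cup J}$ if $S_i\le S'_i$, $T_i\le T'_i$ for $i\in I$. Global types coinductively: $\mathbb{G}::=\mathtt{end}\mid\mathtt{p}\to\mathtt{q}:\{\ell_i(S_i).\mathbb{G}_i\}_{i\in I}$; $\mathrm{pt}(\mathbb{G})$ least solution of $\mathrm{pt}(\mathtt{end})=\emptyset$, $\mathrm{pt}(\mathtt{p}\to\mathtt{q}:\{\ell_i(S_i).\mathbb{G}_i\})=\{\mathtt{p},\mathtt{q}\}\cup\bigcup_i\mathrm{pt}(\mathbb{G}_i)$. Projection $\mathbb{G}\upharpoonright\mathtt{r}$ is the (functional) largest relation such that: $\mathtt{r}\notin\mathrm{pt}(\mathbb{G})$ gives $\mathtt{end}$; $\mathtt{p}\to\mathtt{r}:\{\ell_i(S_i).\mathbb{G}_i\}$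 gives $\mathtt{p}\&\{\ell_i(S_i).T_i\}$ with $\mathbb{G}_i\upharpoonright\mathtt{r}=T_i$; $\mathtt{r}\to\mathtt{q}:\{\ell_i(S_i).\mathbb{G}_i\}$ gives $\mathtt{q}\oplus\{\ell_i(S_i).T_i\}$ with $\mathbb{G}_i\upharpoonright\mathtt{r}=T_i$; $\mathtt{p}\to\mathtt{q}:\{\ell_i(S_i).\mathbb{G}_i\}$ with $\mathtt{r}\notin\{\mathtt{p},\mathtt{q}\}$ gives $T$ with $\mathbb{G}_i\upharpoonright\mathtt{r}=T$ for all $i$. $\mathbb{G}$ is balanced if for every subtree $\mathbb{G}'$ there is $k$ such that every $\mathtt{p}\in\mathrm{pt}(\mathbb{G}')$ occurs on every path from the root of $\mathbb{G}'$ of length $\ge k$ or ending in $\mathtt{end}$. A local type environment $\Gamma$ is a finite map from participants to local types. $\Gamma\sqsubseteq\mathbb{G}$ (association) iff for all $\mathtt{p}\in\mathrm{pt}(\mathbb{G})$, $\mathtt{p}\in\mathrm{dom}(\Gamma)$ and $\Gamma(\mathtt{p})\le\mathbb{G}\upharpoonright\mathtt{p}$, and for all $\mathtt{p}\notin\mathrm{pt}(\mathbb{G})$, $\mathtt{p}\notin\mathrm{dom}(\Gamma)$ or $\Gamma(\mathtt{p})=\mathtt{end}$. TYPING. $\Theta\vdash P:T$ is the least relation with (expression typing $\Theta\vdash e:S$ standard): $\Theta\vdash\mathbf{0}:\mathtt{end}$; $\Theta,X:T\vdash X:T$; $\Theta,X:T\vdash P:T\Rightarrow\Theta\vdash\mu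 X.P:T$; $\Theta\vdash e:\mathtt{bool}$, $\Theta\vdash P_1:T$, $\Theta\vdash P_2:T\Rightarrow\Theta\vdash\mathtt{if}\ e\ \mathtt{then}\ P_1\ \mathtt{else}\ P_2:T$; $\Theta\vdash P:T$, $T\le T'\Rightarrow\Theta\vdash P:T'$; $\forall i\in I.\ \Theta,x_i:S_i\vdash P_i:T_i\Rightarrow\Theta\vdash\sum_{i\in I}\mathtt{p}?\ell_i(x_i).P_i:\mathtt{p}\&\{\ell_i(S_i).T_i\}_{i\in I}$; $\Theta\vdash e:S$, $\Theta\vdash P:T\Rightarrow\Theta\vdash\mathtt{p}!\ell(e).P:\mathtt{p}\oplus\{\ell(S).T\}$. Session typing: $\Gamma\vdash\prod_{i\in I}\mathtt{p}_i\triangleleft P_i$ iff for all $i\in I$, $\emptyset\vdash P_i:\Gamma(\mathtt{p}_i)$, and $\Gamma\sqsubseteq\mathbb{G}$ for some balanced, well-formed global type $\mathbb{G}$ projectable onto every participant.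
   Formalization: The participants of the initial session M are assumed pairwise distinct; with two components for the same participant the claim fails (two copies of p sending a then b to a q that receives a then b). *)

(* Defs.v *)
From Stdlib Require List.
From Stdlib Require Import Relation_Operators.
From mathcomp Require Import all_boot all_order all_algebra.
From mathcomp Require Import finmap.

Set Implicit Arguments.
Unset Strict Implicit.
Unset Printing Implicit Defensive.

Definition part := nat.
Definition label := nat.

(* A family {l_i : a_i}_{i in I} with pairwise distinct labels is a finite map
   from labels, represented by an association list that is only ever inspected
   through [get] (the first binding of a label counts) and through its set of
   labels [unzip1 bs].  In particular the order of the branches is irrelevant,
   and "i in I" reads [l_i \in unzip1 bs]. *)
Notation branches A := (seq (label * A)).

Fixpoint get (A : Type) (l : label) (bs : branches A) : option A :=
  if bs is (l', a) :: bs' then if l == l' then Some a else get l bs' else None.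

(** * Expressions *)

Inductive value : Type :=
  | v_bool of bool
  | v_int of int
  | v_nat of nat.

(* Expression variables are de Bruijn indices. *)
Inductive expr : Type :=
  | e_var of nat
  | e_val of value
  | e_succ of expr
  | e_neg of expr
  | e_not of expr
  | e_gt of expr & expr
  | e_choice of expr & expr.

Definition int_of_value (v : value) : option int :=
  match v with
  | v_bool _ => None
  | v_int z => Some z
  | v_nat n => Some (Posz n)
  end.

Inductive eval : expr -> value -> Prop :=
  | ev_val v : eval (e_val v) v
  | ev_succ e n : eval e (v_nat n) -> eval (e_succ e) (v_nat n.+1)
  | ev_neg e v z : eval e v -> int_of_value v = Some z ->
      eval (e_neg e) (v_int (- z)%R)
  | ev_not e b : eval e (v_bool b) -> eval (e_not e) (v_bool (~~ b))
  | ev_gt e1 e2 v1 v2 z1 z2 :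
      eval e1 v1 -> eval e2 v2 ->
      int_of_value v1 = Some z1 -> int_of_value v2 = Some z2 ->
      eval (e_gt e1 e2) (v_bool (z2 < z1)%R)
  | ev_choicel e1 e2 v : eval e1 v -> eval (e_choice e1 e2) v
  | ev_choicer e1 e2 v : eval e2 v -> eval (e_choice e1 e2) v.

Fixpoint eshift (c : nat) (e : expr) : expr :=
  match e with
  | e_var i => e_var (if c <= i then i.+1 else i)
  | e_val v => e_val v
  | e_succ e1 => e_succ (eshift c e1)
  | e_neg e1 => e_neg (eshift c e1)
  | e_not e1 => e_not (eshift c e1)
  | e_gt e1 e2 => e_gt (eshift c e1) (eshift c e2)
  | e_choice e1 e2 => e_choice (eshift c e1) (eshift c e2)
  end.

Fixpoint esubst (k : nat) (v : value) (e : expr) : expr :=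
  match e with
  | e_var i => if i == k then e_val v else e_var (if k < i then i.-1 else i)
  | e_val w => e_val w
  | e_succ e1 => e_succ (esubst k v e1)
  | e_neg e1 => e_neg (esubst k v e1)
  | e_not e1 => e_not (esubst k v e1)
  | e_gt e1 e2 => e_gt (esubst k v e1) (esubst k v e2)
  | e_choice e1 e2 => e_choice (esubst k v e1) (esubst k v e2)
  end.

(** * Processes *)

(* Two separate de Bruijn name spaces: each branch of [p_recv] binds one
   expression variable (the x_i of p?l_i(x_i).P_i), and [p_rec] binds one
   process variable. *)
Inductive process : Type :=
  | p_send of part & label & expr & process
  | p_recv of part & branches process
  | p_ite of expr & process & process
  | p_rec of process
  | p_var of nat
  | p_inact.

(* Shift of the expression variables. *)
Fixpoint pshifte (c : nat) (P : process) : process :=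
  match P with
  | p_send p l e Q => p_send p l (eshift c e) (pshifte c Q)
  | p_recv p bs => p_recv p (map (fun b => (b.1, pshifte c.+1 b.2)) bs)
  | p_ite e Q R => p_ite (eshift c e) (pshifte c Q) (pshifte c R)
  | p_rec Q => p_rec (pshifte c Q)
  | p_var i => p_var i
  | p_inact => p_inact
  end.

(* Shift of the process variables. *)
Fixpoint pshiftp (c : nat) (P : process) : process :=
  match P with
  | p_send p l e Q => p_send p l e (pshiftp c Q)
  | p_recv p bs => p_recv p (map (fun b => (b.1, pshiftp c b.2)) bs)
  | p_ite e Q R => p_ite e (pshiftp c Q) (pshiftp c R)
  | p_rec Q => p_rec (pshiftp c.+1 Q)
  | p_var i => p_var (if c <= i then i.+1 else i)
  | p_inact => p_inact
  end.

(* P[v/x], for the expression variable x of index k. *)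
Fixpoint psubste (k : nat) (v : value) (P : process) : process :=
  match P with
  | p_send p l e Q => p_send p l (esubst k v e) (psubste k v Q)
  | p_recv p bs => p_recv p (map (fun b => (b.1, psubste k.+1 v b.2)) bs)
  | p_ite e Q R => p_ite (esubst k v e) (psubste k v Q) (psubste k v R)
  | p_rec Q => p_rec (psubste k v Q)
  | p_var i => p_var i
  | p_inact => p_inact
  end.

(* P[N/X], for the process variable X of index k. *)
Fixpoint psubstp (k : nat) (N : process) (P : process) : process :=
  match P with
  | p_send p l e Q => p_send p l e (psubstp k N Q)
  | p_recv p bs =>
      p_recv p (map (fun b => (b.1, psubstp k (pshifte 0 N) b.2)) bs)
  | p_ite e Q R => p_ite e (psubstp k N Q) (psubstp k N R)
  | p_rec Q => p_rec (psubstp k.+1 (pshiftp 0 N) Q)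
  | p_var i => if i == k then N else p_var (if k < i then i.-1 else i)
  | p_inact => p_inact
  end.

(* The process variable of index k occurs in P only below a send or receive
   prefix. *)
Fixpoint guarded (k : nat) (P : process) : bool :=
  match P with
  | p_send _ _ _ _ | p_recv _ _ | p_inact => true
  | p_ite _ Q R => guarded k Q && guarded k R
  | p_rec Q => guarded k.+1 Q
  | p_var i => i != k
  end.

(* The side conditions of the grammar: external choices are nonempty and
   recursion is guarded. *)
Fixpoint wf_process (P : process) : bool :=
  match P with
  | p_send _ _ _ Q => wf_process Q
  | p_recv _ bs => (0 < size bs) && all (fun b => wf_process b.2) bs
  | p_ite _ Q R => wf_process Q && wf_process R
  | p_rec Q => guarded 0 Q && wf_process Q
  | p_var _ | p_inact => true
  end.

(** * Sessions *)

Inductive session : Type :=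
  | s_proc of part & process
  | s_par of session & session
  | s_nil.

Fixpoint components (M : session) : seq (part * process) :=
  match M with
  | s_proc p P => [:: (p, P)]
  | s_par M1 M2 => components M1 ++ components M2
  | s_nil => [::]
  end.

(* In a session \prod_(i in I) p_i <| P_i the p_i are pairwise distinct. *)
Definition wf_session (M : session) : bool :=
  uniq (unzip1 (components M)) && all (fun c => wf_process c.2) (components M).

Inductive scong : session -> session -> Prop :=
  | sc_refl M : scong M M
  | sc_sym M N : scong M N -> scong N M
  | sc_trans L M N : scong L M -> scong M N -> scong L N
  | sc_par M M' N N' : scong M M' -> scong N N' ->
      scong (s_par M N) (s_par M' N')
  | sc_parC M N : scong (s_par M N) (s_par N M)
  | sc_parA L M N : scong (s_par (s_par L M) N) (s_par L (s_par M N))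
  | sc_par0 M : scong (s_par M s_nil) M.

Inductive unfolds : session -> session -> Prop :=
  | un_cong M N : scong M N -> unfolds M N
  | un_trans L M N : unfolds L M -> unfolds M N -> unfolds L N
  | un_rec p P N :
      unfolds (s_par (s_proc p (p_rec P)) N)
              (s_par (s_proc p (psubstp 0 (p_rec P) P)) N)
  | un_true p e P Q N : eval e (v_bool true) ->
      unfolds (s_par (s_proc p (p_ite e P Q)) N) (s_par (s_proc p P) N)
  | un_false p e P Q N : eval e (v_bool false) ->
      unfolds (s_par (s_proc p (p_ite e P Q)) N) (s_par (s_proc p Q) N).

(* The transition label (p, q, l) is (p, q)l: p sends l to q. *)
Inductive lred : session -> part * part * label -> session -> Prop :=
  | r_comm p q l e v bs P Q N :
      get l bs = Some P -> eval e v ->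
      lred (s_par (s_par (s_proc q (p_recv p bs)) (s_proc p (p_send q l e Q))) N)
           (p, q, l)
           (s_par (s_par (s_proc q (psubste 0 v P)) (s_proc p Q)) N)
  | r_unfold M M' N' N a :
      unfolds M M' -> lred M' a N' -> unfolds N' N -> lred M a N.

Definition red (M M' : session) : Prop := exists a, lred M a M'.

Definition reds : session -> session -> Prop := clos_refl_trans session red.

(** * Types *)

Inductive srt : Type := srt_int | srt_bool | srt_nat.

Inductive subsort : srt -> srt -> Prop :=
  | ss_refl S : subsort S S
  | ss_nat_int : subsort srt_nat srt_int.

CoInductive ltype : Type :=
  | l_end
  | l_recv of part & branches (srt * ltype)
  | l_send of part & branches (srt * ltype).

Inductive lsubtree : ltype -> ltype -> Prop :=
  | ls_refl T : lsubtree T T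
  | ls_recv p bs l S T T' : get l bs = Some (S, T) -> lsubtree T T' ->
      lsubtree (l_recv p bs) T'
  | ls_send p bs l S T T' : get l bs = Some (S, T) -> lsubtree T T' ->
      lsubtree (l_send p bs) T'.

(* All the choices in T are nonempty. *)
Definition wf_ltype (T : ltype) : Prop :=
  forall p bs, lsubtree T (l_recv p bs) \/ lsubtree T (l_send p bs) ->
    0 < size bs.

Inductive subtype_gen (R : ltype -> ltype -> Prop) : ltype -> ltype -> Prop :=
  | st_end : subtype_gen R l_end l_end
  | st_recv p bs bs' :
      (forall l S' T', get l bs' = Some (S', T') ->
         exists S T, [/\ get l bs = Some (S, T), subsort S' S & R T T']) ->
      subtype_gen R (l_recv p bs) (l_recv p bs')
  | st_send p bs bs' :
      (forall l S T, get l bs = Some (S, T) ->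
         exists S' T', [/\ get l bs' = Some (S', T'), subsort S S' & R T T']) ->
      subtype_gen R (l_send p bs) (l_send p bs').

(* The largest relation closed (backwards) under the rules: the union of all
   the relations that are. *)
Definition subtype (T T' : ltype) : Prop :=
  exists R : ltype -> ltype -> Prop,
    (forall U U', R U U' -> subtype_gen R U U') /\ R T T'.

CoInductive gtype : Type :=
  | g_end
  | g_comm of part & part & branches (srt * gtype).

(* p \in pt(G) *)
Inductive inpt (r : part) : gtype -> Prop :=
  | pt_head p q bs : r = p \/ r = q -> inpt r (g_comm p q bs)
  | pt_branch p q bs l S G : get l bs = Some (S, G) -> inpt r G ->
      inpt r (g_comm p q bs).

(* [gpath G w G']: a path of length [size w] leads from the root of G to the
   subtree G', and w lists the pairs of participants met on the way. *)
Inductive gpath : gtype -> seq (part * part) -> gtype -> Prop :=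
  | gp_nil G : gpath G [::] G
  | gp_cons p q bs l S G w G' : get l bs = Some (S, G) -> gpath G w G' ->
      gpath (g_comm p q bs) ((p, q) :: w) G'.

Definition gsubtree (G G' : gtype) : Prop := exists w, gpath G w G'.

Definition occurs (r : part) (w : seq (part * part)) : bool :=
  has (fun c => (r == c.1) || (r == c.2)) w.

Definition balanced (G : gtype) : Prop :=
  forall G', gsubtree G G' ->
  exists k, forall p, inpt p G' ->
  forall w G'', gpath G' w G'' -> k <= size w \/ G'' = g_end -> occurs p w.

(* No self-communication, and all the choices in G are nonempty. *)
Definition wf_gtype (G : gtype) : Prop :=
  forall p q bs, gsubtree G (g_comm p q bs) -> p <> q /\ 0 < size bs.

(* The premise [inpt r _] of [pj_skip] separates this rule from [pj_end]; on
   infinite trees projection would not be functional without it. *)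
Inductive proj_gen (r : part) (R : gtype -> ltype -> Prop) :
    gtype -> ltype -> Prop :=
  | pj_end G : ~ inpt r G -> proj_gen r R G l_end
  | pj_recv p bs bs' :
      unzip1 bs =i unzip1 bs' ->
      (forall l S G S' T, get l bs = Some (S, G) -> get l bs' = Some (S', T) ->
         S = S' /\ R G T) ->
      proj_gen r R (g_comm p r bs) (l_recv p bs')
  | pj_send q bs bs' :
      unzip1 bs =i unzip1 bs' ->
      (forall l S G S' T, get l bs = Some (S, G) -> get l bs' = Some (S', T) ->
         S = S' /\ R G T) ->
      proj_gen r R (g_comm r q bs) (l_send q bs')
  | pj_skip p q bs T :
      r <> p -> r <> q -> inpt r (g_comm p q bs) ->
      (forall l S G, get l bs = Some (S, G) -> R G T) ->
      proj_gen r R (g_comm p q bs) T.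

(* [proj G r T]: the projection of G onto r is T. *)
Definition proj (G : gtype) (r : part) (T : ltype) : Prop :=
  exists R : gtype -> ltype -> Prop,
    (forall G' T', R G' T' -> proj_gen r R G' T') /\ R G T.

Definition projectable (G : gtype) : Prop := forall r, exists T, proj G r T.

Definition lenv := {fmap part -> ltype}.

Definition wf_lenv (Gamma : lenv) : Prop :=
  forall p T, fnd Gamma p = Some T -> wf_ltype T.

Definition assoc (Gamma : lenv) (G : gtype) : Prop :=
  (forall p, inpt p G ->
     exists T U, [/\ fnd Gamma p = Some T, proj G p U & subtype T U]) /\
  (forall p, ~ inpt p G -> fnd Gamma p = None \/ fnd Gamma p = Some l_end).

(** * Typing *)

Inductive typ_expr (Delta : seq srt) : expr -> srt -> Prop :=
  | te_var i S : onth Delta i = Some S -> typ_expr Delta (e_var i) S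
  | te_bool b : typ_expr Delta (e_val (v_bool b)) srt_bool
  | te_int z : typ_expr Delta (e_val (v_int z)) srt_int
  | te_nat n : typ_expr Delta (e_val (v_nat n)) srt_nat
  | te_succ e : typ_expr Delta e srt_nat -> typ_expr Delta (e_succ e) srt_nat
  | te_neg e : typ_expr Delta e srt_int -> typ_expr Delta (e_neg e) srt_int
  | te_not e : typ_expr Delta e srt_bool -> typ_expr Delta (e_not e) srt_bool
  | te_gt e1 e2 : typ_expr Delta e1 srt_int -> typ_expr Delta e2 srt_int ->
      typ_expr Delta (e_gt e1 e2) srt_bool
  | te_choice e1 e2 S : typ_expr Delta e1 S -> typ_expr Delta e2 S ->
      typ_expr Delta (e_choice e1 e2) S
  | te_sub e S S' : typ_expr Delta e S -> subsort S S' -> typ_expr Delta e S'.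

(* The typing context is split into the sorts Delta of the expression variables
   and the local types Theta of the process variables. *)
Inductive typ_proc : seq srt -> seq ltype -> process -> ltype -> Prop :=
  | t_inact Delta Theta : typ_proc Delta Theta p_inact l_end
  | t_var Delta Theta i T : onth Theta i = Some T ->
      typ_proc Delta Theta (p_var i) T
  | t_rec Delta Theta P T : wf_ltype T ->
      typ_proc Delta (T :: Theta) P T -> typ_proc Delta Theta (p_rec P) T
  | t_ite Delta Theta e P Q T : typ_expr Delta e srt_bool ->
      typ_proc Delta Theta P T -> typ_proc Delta Theta Q T ->
      typ_proc Delta Theta (p_ite e P Q) T
  | t_sub Delta Theta P T T' : typ_proc Delta Theta P T ->
      wf_ltype T' -> subtype T T' -> typ_proc Delta Theta P T'
  | t_recv Delta Theta p (Ps : branches process) (Ts : branches (srt * ltype)) :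
      unzip1 Ps =i unzip1 Ts ->
      (forall l P S T, get l Ps = Some P -> get l Ts = Some (S, T) ->
         typ_proc (S :: Delta) Theta P T) ->
      typ_proc Delta Theta (p_recv p Ps) (l_recv p Ts)
  | t_send Delta Theta p l e P S T : typ_expr Delta e S ->
      typ_proc Delta Theta P T ->
      typ_proc Delta Theta (p_send p l e P) (l_send p [:: (l, (S, T))]).

(* The domain of Gamma may contain participants that do not occur in M. *)
Definition typ_sess (Gamma : lenv) (M : session) : Prop :=
  (forall p P, List.In (p, P) (components M) ->
     exists T, fnd Gamma p = Some T /\ typ_proc [::] [::] P T) /\
  exists G, [/\ wf_gtype G, balanced G, projectable G & assoc Gamma G].

(* Main.v *)
Require Import Defs.
From mathcomp Require Import all_boot.

Set Implicit Arguments.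
Unset Strict Implicit.
Unset Printing Implicit Defensive.

(** Label safety does not depend on sorts, so process typing is first erased to
    a judgement that ignores expressions.  The invariant of reduction is that
    some global type [G] is projectable, that every participant of a subtree of
    [G] is met along all the paths of this subtree, and that each component is
    typed by the projection of [G].  If [p] is about to send to [q] and [q] to
    receive from [p], the first node of [G] involving either of them is
    [p -> q], whence the two projections offer the same labels; balancedness
    makes this node occur at finite depth on every path, so that firing it is
    an inductive relation on global types, under which the invariant is
    preserved. *)

(** * Branches *)

Lemma get_mem (A : Type) (l : label) (bs : branches A) a :
  get l bs = Some a -> l \in unzip1 bs.
Proof.
elim: bs => //= -[l' b] bs IH /=; rewrite inE.
by case: eqP => //= _ /IH.
Qed.

Lemma mem_get (A : Type) (l : label) (bs : branches A) :
  l \in unzip1 bs -> exists a, get l bs = Some a.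
Proof.
elim: bs => //= -[l' b] bs IH /=; rewrite inE.
by case: eqP => //= _ _; exists b.
Qed.

Lemma get_eq_labels (A B : Type) (l : label) (bs : branches A)
    (cs : branches B) a :
  unzip1 bs =i unzip1 cs -> get l bs = Some a -> exists b, get l cs = Some b.
Proof. by move=> E gl; apply: mem_get; rewrite -E; apply: get_mem gl. Qed.

Lemma get_map (A B : Type) (f : A -> B) (l : label) (bs : branches A) :
  get l (map (fun b => (b.1, f b.2)) bs) = omap f (get l bs).
Proof. by elim: bs => //= -[l' b] bs IH /=; case: ifP. Qed.

Lemma unzip1_map (A B : Type) (f : A -> B) (bs : branches A) :
  unzip1 (map (fun b => (b.1, f b.2)) bs) = unzip1 bs.
Proof. by rewrite /unzip1 -map_comp; apply: eq_map. Qed.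

(* The predicate [D] is there for the induction: it discards the labels whose
   first binding has already been met. *)
Lemma branches_choice (A B : Type) (R : A -> B -> Prop)
    (bs : branches (srt * A)) (D : pred label) :
  inhabited B ->
  (forall l S a, D l -> get l bs = Some (S, a) -> exists b, R a b) ->
  exists cs : branches (srt * B), unzip1 bs = unzip1 cs /\
    forall l S a S' b, D l -> get l bs = Some (S, a) ->
      get l cs = Some (S', b) -> S = S' /\ R a b.
Proof.
case=> b0; elim: bs D => [|[l0 [S0 a0]] bs IH] D H; first by exists [::].
have [l S a /andP[Dl ll0] gl|cs [Ecs Hcs]] := IH [pred l | D l & l != l0].
  by apply: (H l S a) => //=; rewrite (negbTE ll0).
have [b Hb] : exists b, D l0 -> R a0 b.
  case D0: (D l0); last by exists b0.
  by have [|b Rb] := H l0 S0 a0 D0; [rewrite /= eqxx | exists b].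
exists ((l0, (S0, b)) :: cs); split=> [|l S a S' b']; first by rewrite /= Ecs.
move=> Dl /=; case: eqP => [E|/eqP ll0].
  by move=> [<- <-] [<- <-]; split=> //; apply: Hb; rewrite -E.
by apply: Hcs; rewrite inE Dl.
Qed.

(** * Subtyping *)

Lemma subtype_unfold T T' : subtype T T' -> subtype_gen subtype T T'.
Proof.
case=> R [RP RT]; case: (RP _ _ RT) => [|p bs bs' H|p bs bs' H].
- exact: st_end.
- apply: st_recv => l S' U' /H [S [U [gl sS RU]]].
  by exists S, U; split=> //; exists R.
- apply: st_send => l S U /H [S' [U' [gl sS RU]]].
  by exists S', U'; split=> //; exists R.
Qed.

Lemma subtype_refl T : subtype T T.
Proof.
exists eq; split=> // U _ <-; case: U => [|p bs|p bs].
- exact: st_end.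
- by apply: st_recv => l S U gl; exists S, U; split=> //; constructor.
- by apply: st_send => l S U gl; exists S, U; split=> //; constructor.
Qed.

Lemma subsort_trans S1 S2 S3 : subsort S1 S2 -> subsort S2 S3 -> subsort S1 S3.
Proof. by case=> // H; inversion H; constructor. Qed.

Lemma subtype_trans T U V : subtype T U -> subtype U V -> subtype T V.
Proof.
move=> TU UV.
(* Coinduction with the relational composition of [subtype] with itself. *)
exists (fun T V => exists U, subtype T U /\ subtype U V); split; last by exists U.
move=> {TU UV}T {}V {U} [U [/subtype_unfold TU /subtype_unfold UV]].
case: TU UV => [|p bs bs' H|p bs bs' H] UV; inversion UV as [|? ? cs H'|? ? cs H'].
- exact: st_end.
- apply: st_recv => l S3 T3 /H' [S2 [T2 [g2 s2 t2]]].
  have [S1 [T1 [g1 s1 t1]]] := H _ _ _ g2.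
  by exists S1, T1; split=> //; [apply: subsort_trans s2 s1 | exists T2].
- apply: st_send => l S1 T1 /H [S2 [T2 [g2 s2 t2]]].
  have [S3 [T3 [g3 s3 t3]]] := H' _ _ _ g2.
  by exists S3, T3; split=> //; [apply: subsort_trans s2 s3 | exists T2].
Qed.

(** * Sort-erased process typing *)

(** Sorts survive inside local types but are no longer tied to expressions, so substituting an
    arbitrary value preserves the judgement and no subject reduction for expressions is called
    for. *)
Inductive ptyp : seq ltype -> process -> ltype -> Prop :=
  | ty_inact Theta : ptyp Theta p_inact l_end
  | ty_var Theta i T : onth Theta i = Some T -> ptyp Theta (p_var i) T
  | ty_rec Theta P T : ptyp (T :: Theta) P T -> ptyp Theta (p_rec P) T
  | ty_ite Theta e P Q T : ptyp Theta P T -> ptyp Theta Q T ->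
      ptyp Theta (p_ite e P Q) T
  | ty_sub Theta P T T' : ptyp Theta P T -> subtype T T' -> ptyp Theta P T'
  | ty_recv Theta p (Ps : branches process) (Ts : branches (srt * ltype)) :
      unzip1 Ps =i unzip1 Ts ->
      (forall l P S T, get l Ps = Some P -> get l Ts = Some (S, T) ->
         ptyp Theta P T) ->
      ptyp Theta (p_recv p Ps) (l_recv p Ts)
  | ty_send Theta p l e P S T : ptyp Theta P T ->
      ptyp Theta (p_send p l e P) (l_send p [:: (l, (S, T))]).

Lemma typ_proc_ptyp Delta Theta P T :
  typ_proc Delta Theta P T -> ptyp Theta P T.
Proof.
elim=> {Delta Theta P T}.
- by move=> *; apply: ty_inact.
- by move=> *; apply: ty_var.
- by move=> *; apply: ty_rec.
- by move=> *; apply: ty_ite.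
- by move=> Delta Theta P T T' _ IH _; apply: ty_sub.
- by move=> Delta Theta p Ps Ts E _ IH; apply: ty_recv.
- by move=> *; apply: ty_send.
Qed.

Lemma ptyp_pshifte Theta P T c : ptyp Theta P T -> ptyp Theta (pshifte c P) T.
Proof.
move=> H; elim: H c => {Theta P T} /=.
- by move=> *; apply: ty_inact.
- by move=> *; apply: ty_var.
- by move=> *; apply: ty_rec.
- by move=> *; apply: ty_ite.
- by move=> Theta P T T' _ IH sT c; apply: ty_sub sT.
- move=> Theta p Ps Ts E _ IH c; apply: ty_recv => [l|l P S T].
    by rewrite unzip1_map.
  by rewrite get_map; case gl: (get l Ps) => [P'|] //= [<-] gT; apply: IH gl gT _.
- by move=> *; apply: ty_send.
Qed.

Lemma ptyp_psubste Theta P T k v : ptyp Theta P T -> ptyp Theta (psubste k v P) T.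
Proof.
move=> H; elim: H k => {Theta P T} /=.
- by move=> *; apply: ty_inact.
- by move=> *; apply: ty_var.
- by move=> *; apply: ty_rec.
- by move=> *; apply: ty_ite.
- by move=> Theta P T T' _ IH sT k; apply: ty_sub sT.
- move=> Theta p Ps Ts E _ IH k; apply: ty_recv => [l|l P S T].
    by rewrite unzip1_map.
  by rewrite get_map; case gl: (get l Ps) => [P'|] //= [<-] gT; apply: IH gl gT _.
- by move=> *; apply: ty_send.
Qed.

(** The de Bruijn shift at cutoff [size s1] is the reindexing caused by one inserted entry; this
    serves both shifting and substitution. *)
Lemma onth_cat_insert (A : Type) (s1 s2 : seq A) a i :
  onth (s1 ++ a :: s2) (if size s1 <= i then i.+1 else i) = onth (s1 ++ s2) i.
Proof.
elim: s1 i => //= b s1 IH [|i] //=.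
by rewrite -IH ltnS; case: ifP.
Qed.

Lemma ptyp_pshiftp Theta1 Theta2 P T U : ptyp (Theta1 ++ Theta2) P T ->
  ptyp (Theta1 ++ U :: Theta2) (pshiftp (size Theta1) P) T.
Proof.
move E: (Theta1 ++ Theta2) => Theta H.
elim: H Theta1 E => {Theta P T} /=.
- by move=> *; apply: ty_inact.
- by move=> Theta i T gi Theta1 E; apply: ty_var; rewrite onth_cat_insert E.
- move=> Theta P T _ IH Theta1 E; apply: ty_rec.
  by apply: (IH (T :: Theta1)); rewrite /= E.
- by move=> Theta e P Q T _ IHP _ IHQ Theta1 E; apply: ty_ite; auto.
- by move=> Theta P T T' _ IH sT Theta1 E; apply: ty_sub sT; auto.
- move=> Theta p Ps Ts E _ IH Theta1 ET; apply: ty_recv => [l|l P S T].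
    by rewrite unzip1_map.
  by rewrite get_map; case gl: (get l Ps) => [P'|] //= [<-] gT; apply: IH gl gT _ _.
- by move=> Theta p l e P S T _ IH Theta1 E; apply: ty_send; auto.
Qed.

Lemma ptyp_psubstp Theta1 Theta2 P T U N :
  ptyp (Theta1 ++ U :: Theta2) P T -> ptyp (Theta1 ++ Theta2) N U ->
  ptyp (Theta1 ++ Theta2) (psubstp (size Theta1) N P) T.
Proof.
move E: (Theta1 ++ U :: Theta2) => Theta H.
elim: H Theta1 N E => {Theta P T} /=.
- by move=> *; apply: ty_inact.
- move=> Theta i T gi Theta1 N E HN; case: eqP => [Ei|/eqP ne].
    suff -> : T = U by [].
    move: gi; rewrite -E Ei; elim: (Theta1) => [|V s IH] //=.
    by case.
  (* Shifting the new index gives [i] back, so the lookup goes through the insertion of [U]. *)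
  apply: ty_var; rewrite -gi -E -(@onth_cat_insert _ _ _ U).
  congr onth; case: ltngtP ne => // lt _.
    by case: i lt {gi} => //= i; rewrite ltnS => ->.
  by rewrite leqNgt lt.
- move=> Theta P T _ IH Theta1 N E HN; apply: ty_rec.
  apply: (IH (T :: Theta1)); first by rewrite /= E.
  exact: (@ptyp_pshiftp [::]).
- by move=> Theta e P Q T _ IHP _ IHQ Theta1 N E HN; apply: ty_ite; auto.
- by move=> Theta P T T' _ IH sT Theta1 N E HN; apply: ty_sub sT; auto.
- move=> Theta p Ps Ts E _ IH Theta1 N ET HN; apply: ty_recv => [l|l P S T].
    by rewrite unzip1_map.
  rewrite get_map; case gl: (get l Ps) => [P'|] //= [<-] gT.
  by apply: (IH _ _ _ _ gl gT) => //; apply: ptyp_pshifte.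
- by move=> Theta p l e P S T _ IH Theta1 N E HN; apply: ty_send; auto.
Qed.

(** Subsumption may end the derivation, hence the induction; at [ty_rec] the same [T] types the
    variable and the recursion that replaces it. *)
Lemma ptyp_rec_unfold P T :
  ptyp [::] (p_rec P) T -> ptyp [::] (psubstp 0 (p_rec P) P) T.
Proof.
move E: (p_rec P) => Q; move ET: [::] => Theta H.
elim: H E ET => //= {Theta Q T}.
- move=> Theta Q T HQ _ [->] E; move: HQ; rewrite -E => HQ.
  by apply: (@ptyp_psubstp [::] [::] _ _ T) => //; apply: ty_rec.
- by move=> Theta Q T T' _ IH sT E ET; apply: ty_sub sT; apply: IH.
Qed.

Lemma ptyp_ite_inv Theta e P Q T :
  ptyp Theta (p_ite e P Q) T -> ptyp Theta P T /\ ptyp Theta Q T.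
Proof.
move E: (p_ite e P Q) => R H; elim: H E => //= {Theta R T}.
- by move=> Theta e' P' Q' T HP _ HQ _ [_ -> ->].
- by move=> Theta R T T' _ IH sT /IH [HP HQ]; split; apply: ty_sub sT.
Qed.

(** Consecutive uses of [ty_sub] collapse into one by transitivity, and output subtyping only adds
    labels, so the sent label survives in [cs]. *)
Lemma ptyp_send_inv Theta q l e P T : ptyp Theta (p_send q l e P) T ->
  exists cs S U, [/\ T = l_send q cs, get l cs = Some (S, U) & ptyp Theta P U].
Proof.
move=> H.
have [S [U [HP]]] : exists S U,
    ptyp Theta P U /\ subtype (l_send q [:: (l, (S, U))]) T.
  move E: (p_send q l e P) H => R H; elim: H E => //= {Theta R T}.
  - move=> Theta R T T' _ IH sT /IH [S [U [HP sU]]].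
    by exists S, U; split=> //; apply: subtype_trans sT.
  - move=> Theta p l' e' P' S T HP _ [-> -> _ ->].
    by exists S, T; split=> //; apply: subtype_refl.
move/subtype_unfold => sT; inversion sT as [| |? ? cs Hcs]; subst.
have [|S' [U' [gl _ sU]]] := Hcs l S U; first by rewrite /= eqxx.
by exists cs, S', U'; split=> //; apply: ty_sub sU.
Qed.

(** Dually, input subtyping only removes labels: the process may handle more labels than [cs] lists,
    never fewer. *)
Lemma ptyp_recv_inv Theta p Ps T : ptyp Theta (p_recv p Ps) T ->
  exists cs, T = l_recv p cs /\
    forall l S U, get l cs = Some (S, U) ->
      exists P, get l Ps = Some P /\ ptyp Theta P U.
Proof.
move=> H.
have [Ts [E HP]] : exists Ts, [/\ unzip1 Ps =i unzip1 Ts,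
    forall l P S T, get l Ps = Some P -> get l Ts = Some (S, T) ->
      ptyp Theta P T & subtype (l_recv p Ts) T].
  move E: (p_recv p Ps) H => R H; elim: H E => //= {Theta R T}.
  - move=> Theta R T T' _ IH sT /IH [Ts [E HP sU]].
    by exists Ts; split=> //; apply: subtype_trans sT.
  - move=> Theta p' Ps' Ts E HP _ [-> ->].
    by exists Ts; split=> //; apply: subtype_refl.
move/subtype_unfold => sT; inversion sT as [|? ? cs Hcs|]; subst.
exists cs; split=> // l S U /Hcs [S' [U' [gl _ sU]]].
have [P gP] := get_eq_labels (fun x => esym (E x)) gl.
by exists P; split=> //; apply: ty_sub sU; apply: HP gP gl.
Qed.

(** * Projections *)

Lemma proj_unfold G r T :
  proj G r T -> proj_gen r (fun G' T' => proj G' r T') G T.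
Proof.
case=> R [RP RT].
case: (RP _ _ RT) => [G' H|p bs bs' E H|q bs bs' E H|p q bs T' np nq Hr H].
- exact: pj_end.
- by apply: pj_recv => // l S G' S' T' g g'; have [] := H _ _ _ _ _ g g'; split; last exists R.
- by apply: pj_send => // l S G' S' T' g g'; have [] := H _ _ _ _ _ g g'; split; last exists R.
- by apply: pj_skip => // l S G' g; exists R; split=> //; apply: H g.
Qed.

Lemma proj_fold G r T :
  proj_gen r (fun G' T' => proj G' r T') G T -> proj G r T.
Proof.
(* The one-step unfolding of [proj] contains [proj] by [proj_unfold], hence is itself closed
   backwards. *)
move=> H; exists (proj_gen r (fun G' T' => proj G' r T')); split=> // G' T'.
case=> [G1 H1|p bs bs' E H1|q bs bs' E H1|p q bs T1 np nq Hr H1].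
- exact: pj_end.
- by apply: pj_recv => // l S G1 S' T1 g g'; have [] := H1 _ _ _ _ _ g g'; split=> //; apply: proj_unfold.
- by apply: pj_send => // l S G1 S' T1 g g'; have [] := H1 _ _ _ _ _ g g'; split=> //; apply: proj_unfold.
- by apply: pj_skip => // l S G1 g; apply: proj_unfold; apply: H1 g.
Qed.

Lemma proj_notin G r : ~ inpt r G -> proj G r l_end.
Proof. by move=> H; apply: proj_fold; apply: pj_end. Qed.

(** An occurrence of [r] rules out [pj_end]; [pj_skip] merely passes [l_end] on towards that
    occurrence, and fails where [r] is at the head. *)
Lemma proj_end_notin G r : proj G r l_end -> ~ inpt r G.
Proof.
move=> pG Hr; elim: Hr pG => {G} [p q bs Hr|p q bs l S G gl Hr IH] /proj_unfold H;
  inversion H as [? N| | |? ? ? ? np nq _ HG]; subst.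
- by apply: N; apply: pt_head.
- by case: Hr.
- by apply: N; apply: pt_branch gl Hr.
- exact: IH (HG _ _ _ gl).
Qed.

Lemma proj_inpt G r T : proj G r T -> T <> l_end -> inpt r G.
Proof.
by move=> /proj_unfold [] // *; apply: pt_head; auto.
Qed.

(** The rule [pj_skip] with the occurrence of [r] replaced by the existence of a branch; without
    one, every [T] would satisfy the premise vacuously. *)
Lemma proj_skip p q bs r T l0 b0 :
  r <> p -> r <> q -> get l0 bs = Some b0 ->
  (forall l S G, get l bs = Some (S, G) -> proj G r T) ->
  proj (g_comm p q bs) r T.
Proof.
case: b0 => S0 G0 np nq g0 HG; have pG0 := HG _ _ _ g0.
(* Testing [T] against [l_end] stands in for deciding occurrence in an infinite tree. *)
have [ET|nT] : T = l_end \/ T <> l_end by case: (T); [left|right|right].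
  rewrite ET in HG *; apply: proj_notin => Hr.
  inversion Hr as [? ? ? []|? ? ? l S G gl]; subst => //.
  exact: (proj_end_notin (HG _ _ _ gl)).
apply: proj_fold; apply: pj_skip => //.
exact: pt_branch g0 (proj_inpt pG0 nT).
Qed.

Lemma proj_skip_inv p q bs r T :
  r <> p -> r <> q -> proj (g_comm p q bs) r T ->
  forall l S G, get l bs = Some (S, G) -> proj G r T.
Proof.
move=> np nq /proj_unfold H l S G gl; inversion H as [? N| | |? ? ? ? _ _ _ HG];
  subst => //; last exact: HG gl.
by apply: proj_notin => Hr; apply: N; apply: pt_branch gl Hr.
Qed.

(** Isolates what happens at a node skipped by a global step; the implication between projections
    has the shape of an induction hypothesis on that step. *)
Lemma proj_skip_relabel p q bs bs' r T V :
  r <> p -> r <> q -> unzip1 bs =i unzip1 bs' -> inpt r (g_comm p q bs) ->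
  (forall l S G S' G', get l bs = Some (S, G) -> get l bs' = Some (S', G') ->
     proj G r V -> proj G' r T) ->
  proj (g_comm p q bs) r V -> proj (g_comm p q bs') r T.
Proof.
move=> np nq E Hr H pV.
inversion Hr as [? ? ? []|? ? ? l0 S0 G0 gl0 _]; subst => //.
have [b0 gb0] := get_eq_labels E gl0.
apply: (proj_skip np nq gb0) => l' S' G' gl'.
have [[S G] gl] := get_eq_labels (fun x => esym (E x)) gl'.
by apply: (H _ _ _ _ _ gl gl'); apply: proj_skip_inv pV _ _ _ gl.
Qed.

Lemma projectable_branch p q bs l S G :
  projectable (g_comm p q bs) -> get l bs = Some (S, G) -> projectable G.
Proof.
move=> pG gl r; have [T /proj_unfold H] := pG r.
inversion H as [? N|? ? bs' E HG|? ? bs' E HG|? ? ? ? _ _ _ HG]; subst.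
- by exists l_end; apply: proj_notin => Hr; apply: N; apply: pt_branch gl Hr.
- have [[S' T'] gl'] := get_eq_labels E gl.
  by exists T'; have [] := HG _ _ _ _ _ gl gl'.
- have [[S' T'] gl'] := get_eq_labels E gl.
  by exists T'; have [] := HG _ _ _ _ _ gl gl'.
- by exists T; apply: HG gl.
Qed.

Variant comm_head_spec p q cs ds : gtype -> Prop :=
  | CommHead bs of
      unzip1 bs =i unzip1 cs & unzip1 bs =i unzip1 ds :
      comm_head_spec p q cs ds (g_comm p q bs)
  | CommSkip a b bs of
      p <> a & p <> b & q <> a & q <> b &
      (forall l S G, get l bs = Some (S, G) -> proj G p (l_send q cs)) &
      (forall l S G, get l bs = Some (S, G) -> proj G q (l_recv p ds)) :
      comm_head_spec p q cs ds (g_comm a b bs).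

(** The send forces any head that involves [p] to be [p -> q], and the receive does the same for
    [q]; so the head involves both or neither. *)
Lemma comm_headP p q cs ds G : p <> q ->
  proj G p (l_send q cs) -> proj G q (l_recv p ds) -> comm_head_spec p q cs ds G.
Proof.
move=> npq /proj_unfold Hp /proj_unfold Hq.
inversion Hp as [| |? bs ? E|a b bs ? npa npb _ HGp]; subst;
  inversion Hq as [|? ? ? E'| |? ? ? ? nqa nqb _ HGq]; subst => //.
- exact: CommHead.
- exact: CommSkip HGp HGq.
Qed.

(** A projection other than [l_end] puts [p] at finite depth; induction on that occurrence descends
    to a node [p -> q], which has the labels of both projections. *)
Lemma comm_labels p q cs ds G : p <> q ->
  proj G p (l_send q cs) -> proj G q (l_recv p ds) -> unzip1 cs =i unzip1 ds.
Proof.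
move=> npq Hp Hq; have Hin : inpt p G by apply: proj_inpt Hp _.
elim: Hin Hp Hq => {G} [a b bs Hr|a b bs l S G gl Hr IH] Hp Hq;
  case E: _ / (comm_headP npq Hp Hq) => [bs' E1 E2|a' b' bs' n1 n2 n3 n4 Hp' Hq'].
- by move=> x; rewrite -E1 E2.
- by case: E Hr => -> -> _ [].
- by move=> x; rewrite -E1 E2.
- case: E => _ _ Eb; rewrite Eb in gl.
  by apply: IH; [apply: Hp' gl | apply: Hq' gl].
Qed.

(** * Steps of global types *)

(** Inductive reading of [r] being met on every path: it gives a well-founded descent, with no bound
    to recompute after a step. *)
Inductive eventually (r : part) : gtype -> Prop :=
  | ev_head p q bs : r = p \/ r = q -> eventually r (g_comm p q bs)
  | ev_next p q bs :
      (forall l S G, get l bs = Some (S, G) -> eventually r G) ->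
      eventually r (g_comm p q bs).

Definition fair (G : gtype) : Prop :=
  forall w H r, gpath G w H -> inpt r H -> eventually r H.

Lemma balanced_fair G : balanced G -> fair G.
Proof.
move=> bG w H r /(ex_intro _ w)/bG [k Hk] /Hk {}Hk {w bG}.
elim: k H Hk => [|k IH] [|p q bs] Hk.
(* The empty path already qualifies when [k] is 0 or the tree is [g_end], yet nothing occurs on
   it. *)
- by have := Hk _ _ (gp_nil _) (or_introl (leqnn _)).
- by have := Hk _ _ (gp_nil _) (or_introl (leqnn _)).
- by have := Hk _ _ (gp_nil _) (or_intror (erefl _)).
case: (boolP ((r == p) || (r == q))) => [/orP Hr|/negbTE nr].
  by apply: ev_head; case: Hr => /eqP; auto.
apply: ev_next => l S H gl; apply: IH => w G' Hw Hs.
have /= := Hk _ _ (gp_cons p q gl Hw); rewrite /occurs /= nr /=; apply.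
by case: Hs; auto.
Qed.

Lemma fair_branch p q bs l S G :
  fair (g_comm p q bs) -> get l bs = Some (S, G) -> fair G.
Proof. by move=> fG gl w H r Hw; apply: fG; apply: gp_cons gl Hw. Qed.

(** Since [p] and [q] do not learn which branch of a skipped node is taken, all its branches step.
    Labels and sorts stay fixed there to keep the other projections intact. *)
Inductive gstep (p q : part) (l : label) : gtype -> gtype -> Prop :=
  | gs_comm bs S G : get l bs = Some (S, G) ->
      gstep p q l (g_comm p q bs) G
  | gs_skip a b bs bs' :
      p <> a -> p <> b -> q <> a -> q <> b ->
      unzip1 bs =i unzip1 bs' ->
      (forall l' S G S' G', get l' bs = Some (S, G) ->
         get l' bs' = Some (S', G') -> S = S') ->
      (forall l' S G S' G', get l' bs = Some (S, G) ->
         get l' bs' = Some (S', G') -> gstep p q l G G') ->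
      gstep p q l (g_comm a b bs) (g_comm a b bs').

Lemma gstep_exists p q l cs ds G : p <> q -> eventually p G ->
  proj G p (l_send q cs) -> proj G q (l_recv p ds) -> l \in unzip1 cs ->
  exists G', gstep p q l G G'.
Proof.
move=> npq ev; elim: ev => {G} [a b bs Hr|a b bs _ IH] Hp Hq lcs;
  case E: _ / (comm_headP npq Hp Hq) => [bs' E1 E2|a' b' bs' n1 n2 n3 n4 Hp' Hq'].
- have [|[S G] gl] := @mem_get _ l bs'; first by rewrite E1.
  by exists G; apply: gs_comm gl.
- by case: E Hr => -> -> _ [].
- have [|[S G] gl] := @mem_get _ l bs'; first by rewrite E1.
  by exists G; apply: gs_comm gl.
case: E => Ea Eb Ebs; subst a' b' bs'.
(* The value [g_end] is the default for entries shadowed by an earlier binding of the same label. *)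
have [|l' S G _ gl|bs' [Eb H]] :=
  @branches_choice _ _ (gstep p q l) bs predT; first by exists; apply: g_end.
  by apply: (IH _ _ _ gl) lcs; [apply: Hp' gl | apply: Hq' gl].
exists (g_comm a b bs'); apply: gs_skip => // [x|l' S1 G1 S2 G2 g1 g2|l' S1 G1 S2 G2 g1 g2].
- by rewrite Eb.
- by have [] := H _ _ _ _ _ isT g1 g2.
- by have [] := H _ _ _ _ _ isT g1 g2.
Qed.

Lemma gstep_inpt p q l G G' r : gstep p q l G G' -> inpt r G' -> inpt r G.
Proof.
move=> st; elim: st => {G G'} [bs S G gl|a b bs bs' _ _ _ _ E HS Hst IH] Hr.
  exact: pt_branch gl Hr.
inversion Hr as [? ? ? Hab|? ? ? l' S' G' gl' Hr']; subst; first exact: pt_head.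
have [[S G] gl] := get_eq_labels (fun x => esym (E x)) gl'.
exact: pt_branch gl (IH _ _ _ _ _ gl gl' Hr').
Qed.

(** At the fired node [r] is skipped, so the selected branch has the projection of the whole node.
    Above it [r] may take part, and the unchanged labels and sorts rebuild its projection. *)
Lemma gstep_proj_other p q l G G' r U : r <> p -> r <> q ->
  gstep p q l G G' -> proj G r U -> proj G' r U.
Proof.
move=> rp rq st; elim: st U => {G G'} [bs S G gl|a b bs bs' n1 n2 n3 n4 E HS Hst IH] U.
  by move/proj_skip_inv; apply; eauto.
have E' x : x \in unzip1 bs' = (x \in unzip1 bs) by rewrite E.
move=> /proj_unfold pU.
inversion pU as [? N|? ? cs Ec HG|? ? cs Ec HG|? ? ? ? na nb Hr HG]; subst.
- apply: proj_notin => Hr; apply: N.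
  inversion Hr as [|? ? ? l' S' G' gl' Hr']; subst; first exact: pt_head.
  have [[S G] gl] := get_eq_labels E' gl'.
  have st := Hst _ _ _ _ _ gl gl'.
  exact: pt_branch gl (gstep_inpt st Hr').
- apply: proj_fold; apply: pj_recv => [x|l' S' G' S'' T gl' gc].
    by rewrite E' Ec.
  have [[S G] gl] := get_eq_labels E' gl'.
  rewrite -(HS _ _ _ _ _ gl gl').
  by have [] := HG _ _ _ _ _ gl gc; split=> //; apply: IH gl gl' _ _.
- apply: proj_fold; apply: pj_send => [x|l' S' G' S'' T gl' gc].
    by rewrite E' Ec.
  have [[S G] gl] := get_eq_labels E' gl'.
  rewrite -(HS _ _ _ _ _ gl gl').
  by have [] := HG _ _ _ _ _ gl gc; split=> //; apply: IH gl gl' _ _.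
- apply: proj_skip_relabel Hr _ (proj_fold pU) => // *; apply: IH; eauto.
Qed.

(** Skipped nodes give every branch the same projection [l_send q cs], so after the step all
    branches project to the single [T] that [cs] has at [l]. *)
Lemma gstep_proj_sender p q l G G' cs S T : p <> q ->
  gstep p q l G G' -> proj G p (l_send q cs) -> get l cs = Some (S, T) ->
  proj G' p T.
Proof.
move=> npq st pG gc; elim: st pG => {G G'} [bs S' G gl|a b bs bs' n1 n2 n3 n4 E HS Hst IH] pG.
  have {}pG := proj_unfold pG.
  inversion pG as [| |? ? ? E HG|]; subst => //.
  by have [] := HG _ _ _ _ _ gl gc.
by apply: proj_skip_relabel (proj_inpt pG _) _ pG.
Qed.

Lemma gstep_proj_receiver p q l G G' cs S T : p <> q ->
  gstep p q l G G' -> proj G q (l_recv p cs) -> get l cs = Some (S, T) ->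
  proj G' q T.
Proof.
move=> npq st pG gc; elim: st pG => {G G'} [bs S' G gl|a b bs bs' n1 n2 n3 n4 E HS Hst IH] pG.
  have {}pG := proj_unfold pG.
  inversion pG as [|? ? ? E HG| |]; subst => //.
  by have [] := HG _ _ _ _ _ gl gc.
by apply: proj_skip_relabel (proj_inpt pG _) _ pG.
Qed.

(* A non-[end] projection is propagated by the skipped nodes to all the branches,
   down to subtrees of the original, fair, global type. *)
Lemma gstep_eventually p q l G G' r T : gstep p q l G G' -> fair G ->
  proj G' r T -> T <> l_end -> eventually r G'.
Proof.
move=> st; elim: st => {G G'} [bs S G gl|a b bs bs' _ _ _ _ E HS Hst IH] fG pT nT.
  exact: (fair_branch fG gl) (gp_nil _) (proj_inpt pT nT).
have [/orP Hr|] := boolP ((r == a) || (r == b)).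
  by apply: ev_head; case: Hr => /eqP; auto.
rewrite negb_or => /andP[/eqP na /eqP nb]; apply: ev_next => l' S' G' gl'.
have [[S G] gl] := get_eq_labels (fun x => esym (E x)) gl'.
by apply: (IH _ _ _ _ _ gl gl') nT; [apply: fair_branch fG gl | apply: proj_skip_inv pT _ _ _ gl'].
Qed.

(** Induction on the path into [G']. If it ends before passing the fired node, the projection of [r]
    allows [gstep_eventually]; past that node, the path runs in a subtree of [G] and fairness of [G]
    applies. *)
Lemma gstep_fair p q l G G' :
  gstep p q l G G' -> projectable G' -> fair G -> fair G'.
Proof.
move=> st pG fG w H r Hw; elim: Hw G st pG fG => {G' w H}.
  move=> G' G st pG fG Hr; have [T pT] := pG r.
  by apply: (gstep_eventually st fG pT) => ET; rewrite ET in pT; apply: (proj_end_notin pT).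
move=> a b bs' l' S' G' w H gl' Hw IH G st pG fG.
inversion st as [bs S ? gl|? ? bs ? _ _ _ _ E _ Hst]; subst.
  exact: (fair_branch fG gl) (gp_cons a b gl' Hw).
have [[S G1] gl] := get_eq_labels (fun x => esym (E x)) gl'.
have st1 := Hst _ _ _ _ _ gl gl'.
exact: IH st1 (projectable_branch pG gl') (fair_branch fG gl).
Qed.

(** * Sessions *)

(** The environment disappears: subsumption in [ptyp] absorbs subtyping, so components get exactly
    their projections, and those of participants not occurring in [G] get [l_end]. *)
Definition well_typed (M : session) : Prop :=
  uniq (unzip1 (components M)) /\
  exists G, [/\ projectable G, fair G &
    forall p P, List.In (p, P) (components M) ->
      exists T, proj G p T /\ ptyp [::] P T].

Lemma typ_sess_well_typed Gamma M :
  wf_session M -> typ_sess Gamma M -> well_typed M.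
Proof.
move=> /andP[uM _] [HM [G [_ bG pG [HG1 HG2]]]]; split=> //.
exists G; split=> // [|p P /HM [T [ET /typ_proc_ptyp HP]]]; first exact: balanced_fair.
have [U pU] := pG p.
have [EU|nU] : U = l_end \/ U <> l_end by case: (U); [left|right|right].
  rewrite EU in pU; exists l_end; split=> //.
  by have := HG2 _ (proj_end_notin pU); rewrite ET => -[|[<-]].
have [T' [V [ET' pV sV]]] := HG1 _ (proj_inpt pU nU).
exists V; split=> //; apply: ty_sub sV.
by move: ET'; rewrite ET => -[<-].
Qed.

(** Names are compared up to permutation to carry [uniq]; whole components only by [List.In], as no
    decidable equality on [process] is declared. *)
Lemma scong_components M N : scong M N ->
  perm_eq (unzip1 (components M)) (unzip1 (components N)) /\
  forall c, List.In c (components M) <-> List.In c (components N).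
Proof.
elim=> {M N} [M|M N _ [H1 H2]|L M N _ [H1 H2] _ [H3 H4]
  |M M' N N' _ [H1 H2] _ [H3 H4]|M N|L M N|M] /=.
- by [].
- by split=> [|c]; [rewrite perm_sym | rewrite H2].
- by split=> [|c]; [apply: perm_trans H3 | rewrite H2].
- split=> [|c]; first by rewrite /unzip1 !map_cat perm_cat.
  by rewrite !List.in_app_iff H2 H4.
- split=> [|c]; first by rewrite /unzip1 !map_cat perm_catC.
  by rewrite !List.in_app_iff; tauto.
- by rewrite catA.
- by rewrite cats0.
Qed.

Lemma well_typed_scong M N : scong M N -> well_typed M -> well_typed N.
Proof.
move=> /scong_components [E HE] [uM [G [pG fG HG]]].
split; first by rewrite -(perm_uniq E).
by exists G; split=> // p P /HE; apply: HG.
Qed.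

Lemma well_typed_update p P P' N :
  (forall T, ptyp [::] P T -> ptyp [::] P' T) ->
  well_typed (s_par (s_proc p P) N) -> well_typed (s_par (s_proc p P') N).
Proof.
move=> HP [uM [G [pG fG HG]]]; split=> //; exists G; split=> // r Q /= [[<- <-]|HQ].
  have [|T [pT /HP HT]] := HG p P; first by left.
  by exists T.
by apply: HG; right.
Qed.

Lemma well_typed_unfolds M N : unfolds M N -> well_typed M -> well_typed N.
Proof.
elim=> {M N} [M N /well_typed_scong //|L M N _ H1 _ H2 /H1 //|p P N|p e P Q N _|p e P Q N _];
  apply: well_typed_update => T.
- exact: ptyp_rec_unfold.
- by case/ptyp_ite_inv.
- by case/ptyp_ite_inv.
Qed.

(** Label safety proper: [l] is a label of [cs], hence of [ds] by [comm_labels], and the receiver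
    handles all labels of [ds]. This serves both preservation and the theorem. *)
Lemma well_typed_comm G p q l e P Qs Tp Tq : p <> q ->
  proj G p Tp -> ptyp [::] (p_send q l e P) Tp ->
  proj G q Tq -> ptyp [::] (p_recv p Qs) Tq ->
  exists cs ds S S' T U Q,
    [/\ Tp = l_send q cs, Tq = l_recv p ds,
        get l cs = Some (S, T) & get l ds = Some (S', U)] /\
    [/\ get l Qs = Some Q, ptyp [::] P T & ptyp [::] Q U].
Proof.
move=> npq pp /ptyp_send_inv [cs [S [T [Ep gc HP]]]] pq /ptyp_recv_inv [ds [Eq HQ]].
rewrite Ep in pp; rewrite Eq in pq.
have [[S' U] gd] := get_eq_labels (comm_labels npq pp pq) gc.
have [Q [gQ HQU]] := HQ _ _ _ gd.
by exists cs, ds, S, S', T, U, Q.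
Qed.

Lemma well_typed_lred M a N : lred M a N -> well_typed M -> well_typed N.
Proof.
elim=> {M a N} [p q l e v Qs Q P N gQ _ [uM [G [pG fG HG]]]
  |M M' N' N a /well_typed_unfolds H1 _ IH /well_typed_unfolds H2 /H1/IH/H2 //].
(* The reduct has the same list of names, so [uN] is also its uniqueness. *)
have uN := uM; move: uM => /= /and3P[].
rewrite inE negb_or => /andP[/eqP nqp qN] pN _.
have npq : p <> q by move/esym.
have [|Tq [pq Hq]] := HG q (p_recv p Qs); first by left.
have [|Tp [pp Hp]] := HG p (p_send q l e P); first by right; left.
have [cs [ds [S [S' [T [U [Q' [[Ep Eq gc gd] [gQ' HP HQ]]]]]]]]] :=
  well_typed_comm npq pp Hp pq Hq.
rewrite Ep in pp; rewrite Eq in pq; move: gQ'; rewrite gQ => -[EQ]; subst Q'.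
have evp : eventually p G.
  by apply: fG (gp_nil _) _; apply: (proj_inpt pp).
have [G' st] := gstep_exists npq evp pp pq (get_mem gc).
have pp' := gstep_proj_sender npq st pp gc.
have pq' := gstep_proj_receiver npq st pq gd.
have pG' : projectable G'.
  move=> r; case: (eqVneq r p) => [->|/eqP rp]; first by exists T.
  case: (eqVneq r q) => [->|/eqP rq]; first by exists U.
  by have [V pV] := pG r; exists V; apply: (gstep_proj_other rp rq st pV).
split=> //; exists G'; split=> //; first exact: gstep_fair st pG' fG.
move=> r R /= [[<- <-]|[[<- <-]|HR]].
- by exists U; split=> //; apply: ptyp_psubste.
- by exists T.
(* Distinct names keep the remaining components away from [p] and [q], so their projections do not
   move. *)
have rN : r \in unzip1 (components N).
  elim: (components N) HR => //= -[r' R'] s IH; rewrite inE => -[[-> _]|/IH ->].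
    by rewrite eqxx.
  by rewrite orbT.
have [|V [pV HV]] := HG r R; first by right; right.
have rp : r <> p by move=> E; rewrite -E rN in pN.
have rq : r <> q by move=> E; rewrite -E rN in qN.
by exists V; split=> //; apply: gstep_proj_other rp rq st pV.
Qed.

Lemma well_typed_reds M N : reds M N -> well_typed M -> well_typed N.
Proof.
elim=> {M N} [M N [a /well_typed_lred]|M|L M N _ H1 _ H2] //.
by move/H1/H2.
Qed.

Theorem mainTheorem7 (Gamma : lenv) (M M' : session) :
  wf_lenv Gamma -> wf_session M -> typ_sess Gamma M -> reds M M' ->
  forall (p q : part) (l : label) (e : expr) (P : process)
         (Qs : seq (label * process)) (M'' : session),
    unfolds M' (s_par (s_par (s_proc p (p_send q l e P))
                             (s_proc q (p_recv p Qs))) M'') ->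
    l \in unzip1 Qs.
Proof.
move=> _ wM /(typ_sess_well_typed wM) HM /well_typed_reds/(_ HM) HM'.
move=> p q l e P Qs M'' /well_typed_unfolds/(_ HM') [uM [G [pG fG HG]]].
(* Names stay distinct in the unfolded session, hence [p <> q]. *)
move: uM => /= /and3P[]; rewrite inE negb_or => /andP[/eqP npq _] _ _.
have [|Tp [pp Hp]] := HG p (p_send q l e P); first by left.
have [|Tq [pq Hq]] := HG q (p_recv p Qs); first by right; left.
have [cs [ds [S [S' [T [U [Q [_ [gQ _ _]]]]]]]]] := well_typed_comm npq pp Hp pq Hq.
exact: get_mem gQ.
Qed.
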